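(* Let $k$ be an algebraically closed field, let $r\ge 2$ and let $(a,b)\in\mathbb{N}_0^2$ be such that $q_{\Gamma_r}(a,b)\le 1$, where $q_{\Gamma_r}(x,y)=x^2+y^2-rxy$. If $b-a\ge r-1$ or $(a,b)=(0,1)$, then there exists an indecomposable representation $V_{(a,b)}\in\mathrm{rep}(\Gamma_r)$ such that $V_{(a,b)}$ has the equal kernels property and $\underline{\dim}\,V_{(a,b)}=(a,b)$. Hence $$\{\underline{\dim}\,M \mid M\in\mathrm{EKP}\text{ indecomposable}\}=\{(a,b)\in\mathbb{N}_0\times\mathbb{N}_0 \mid q_{\Gamma_r}(a,b)\le 1,\ b-a\ge r-1\}\cup\{(0,1)\}.$$
   Context: $k$ has arbitrary characteristic; $\mathbb{N}_0=\{0,1,2,\dots\}$. $\Gamma_r$ is the Kronecker quiver with two vertices $1,2$ and $r$ arrows $\gamma_1,\dots,\gamma_r\colon 1\to 2$; $\mathrm{rep}(\Gamma_r)$ is the category of its finite-dimensional $k$-representations $M=(M_1,M_2,M(\gamma_i))$, and $\underline{\dim}\,M=(\dim_k M_1,\dim_k M_2)$. For $\alpha\in k^r\setminus\{0\}$ put $M^\alpha:=\sum_{i=1}^r\alpha_iM(\gamma_i)\colon M_1\to M_2$. $M$ has the equal kernels property if $\ker M^\alpha$ is independent of $\alpha\in k^r\setminus\{0\}$; $\mathrm{EKP}$ is the class of all $M\in\mathrm{rep}(\Gamma_r)$ with $\ker M^\alpha=\{0\}$ for all $\alpha\in k^r\setminus\{0\}$ (for indecomposable non-simple $M$ the two conditions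 are equivalent). *)

(* Defs.v *)
From mathcomp Require Import all_boot all_order all_algebra.
From mathcomp Require Import boolp classical_sets.

Set Implicit Arguments.
Unset Strict Implicit.
Unset Printing Implicit Defensive.

Import Order.TTheory GRing.Theory Num.Theory.
Local Open Scope ring_scope.

(* A finite-dimensional representation of the Kronecker quiver with r arrows.
   A [vectType] is automatically finite-dimensional. *)
Record kronecker_rep (k : fieldType) (r : nat) := KroneckerRep {
  rep1 : vectType k;
  rep2 : vectType k;
  rep_arrow : 'I_r -> 'Hom(rep1, rep2)
}.

Section KroneckerRep.
Variables (k : fieldType) (r : nat).
Implicit Type M : kronecker_rep k r.

Definition dim_vector M : nat * nat := (\dim {:rep1 M}, \dim {:rep2 M}).

Definition rep_comb M (alpha : 'rV[k]_r) : 'Hom(rep1 M, rep2 M) :=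
  \sum_(i < r) alpha 0 i *: rep_arrow M i.

Definition equal_kernels_property M : Prop :=
  forall alpha beta : 'rV[k]_r, alpha != 0 -> beta != 0 ->
    lker (rep_comb M alpha) = lker (rep_comb M beta).

(* The class EKP; it differs from [equal_kernels_property], which also holds,
   for instance, for the simple representation of dimension vector (1, 0). *)
Definition EKP M : Prop :=
  forall alpha : 'rV[k]_r, alpha != 0 -> lker (rep_comb M alpha) = 0%VS.

Definition subrep M (U1 : {vspace rep1 M}) (U2 : {vspace rep2 M}) : Prop :=
  forall i : 'I_r, (rep_arrow M i @: U1 <= U2)%VS.

(* (U1, U2) and (W1, W2) are subrepresentations whose internal direct sum
   is M. *)
Definition direct_decomp M (U1 : {vspace rep1 M}) (U2 : {vspace rep2 M})
    (W1 : {vspace rep1 M}) (W2 : {vspace rep2 M}) : Prop :=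
  [/\ subrep U1 U2, subrep W1 W2,
      (U1 + W1 = fullv)%VS /\ (U1 :&: W1 = 0)%VS
    & (U2 + W2 = fullv)%VS /\ (U2 :&: W2 = 0)%VS].

(* The zero representation is not indecomposable. *)
Definition indecomposable M : Prop :=
  dim_vector M <> (0, 0)%N /\
  forall (U1 : {vspace rep1 M}) (U2 : {vspace rep2 M})
         (W1 : {vspace rep1 M}) (W2 : {vspace rep2 M}),
    direct_decomp U1 U2 W1 W2 ->
    (U1 = 0%VS /\ U2 = 0%VS) \/ (W1 = 0%VS /\ W2 = 0%VS).

End KroneckerRep.

Definition kronecker_form (r : nat) (x y : int) : int :=
  x ^+ 2 + y ^+ 2 - r%:Z * x * y.

(* Main.v *)
From HB Require Import structures.
Require Import Defs.
From mathcomp Require Import all_boot all_order all_algebra.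
From mathcomp Require Import boolp classical_sets.
From mathcomp Require Import zify ring.

Set Implicit Arguments.
Unset Strict Implicit.
Unset Printing Implicit Defensive.

Import Order.TTheory GRing.Theory Num.Theory.
Local Open Scope classical_set_scope.
Local Open Scope ring_scope.

(** Write q(x, y) = x^2 + y^2 - r x y, and let M be a representation with
    dimension vector (a, b).

    EKP forces b - a >= r - 1 (when a > 0).  The class EKP consists of the M
    for which the bilinear map k^r x M_1 -> M_2 kills no pair of nonzero
    vectors: in coordinates, b bilinear forms without common zero on
    P^(r-1) x P^(a-1).  Over an algebraically closed field this needs
    b > r + a - 2 ([bilinear_zero]).  The proof of this dimension bound works
    in the dual of the coordinate ring of the Segre variety.  Let D_d be the
    dual of the forms of bidegree (d, d); a bilinear form w acts by contraction
    D_(d+1) -> D_d, the transpose of multiplication by w.  For a list ws of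
    bilinear forms, the part K_d(ws) of D_d killed by ws is the dual of degree
    d of the quotient ring by ws.  One further form lowers the order of growth
    of d |-> dim K_d by at most one, and dim D_d grows like d^(r+a-2), so fewer
    than r + a - 1 forms cannot make K_d vanish ([nonpersistent_growth]).  If
    K_d(ws) vanishes for no d, then ws has a common zero ([persistent_zero]):
    enlarge ws to a maximal list with this property; an eigenvalue argument
    shows that its span is a hyperplane, hence the kernel of a linear form on
    r x a matrices, and the Segre relations say that this linear form is a
    nonzero rank one matrix alpha_i x_l.

    Indecomposability forces q(a, b) <= 1 (when a < b).  Reflection at the sink
    replaces M by (ker(M_1^r -> M_2), M_1); it preserves indecomposability
    ([sink_reflection_indecomposable]) and q, and changes (a, b) into
    (r a - b, a).  If q(a, b) > 1 and a < b, then r a - b < a, so iterating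
    leads to an indecomposable representation of dimension vector (0, b).  Then
    b = 1 and q = 1, a contradiction.

    Existence.  A vector space X and a subspace N of X^r give a representation
    X -> X^r / N.  It is in EKP iff N contains no nonzero pure tensor, and it
    is indecomposable iff N does not split along a decomposition of X
    ([copresentation_exists]).  An indecomposable L in EKP of dimension vector
    (n, a) embeds L_1 into L_2^r, and this subspace has both properties, which
    yields (a, r a - n) ([EKP_lift]).  This settles b >= (r - 1)(a + 1) by
    induction.  For smaller b take for X the polynomials of degree < a and for
    N a space of syzygies, that is of tuples f with sum_i t^i f_i = 0: such a
    tuple is never a pure tensor alpha_i g, because k[t] is a domain.
    An endomorphism of X that preserves N must be a scalar as soon as N
    contains all the (t p, -p, 0, ..., 0); this covers b <= (r - 1) a + 1
    ([near_diagonal_exists]).  For b = (r - 1) a + c with 2 <= c <= r - 2 take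
    for N the multiples of one syzygy whose components span the polynomials of
    degree <= c ([far_diagonal_exists]). *)

(** * Linear algebra *)

Lemma linfun_linearE (k : fieldType) (U V : vectType k) (f : U -> V) :
  linear f -> linfun f =1 f.
Proof.
move=> fL u; pose fLM := GRing.isLinear.Build _ _ _ _ f fL.
pose g : {linear _ -> _} := HB.pack f fLM.
exact: (lfunE g).
Qed.

Lemma scale_inj (k : fieldType) (V : vectType k) (v : V) :
  v != 0 -> injective (fun x : k => x *: v).
Proof.
move=> v0 x y /eqP; rewrite -subr_eq0 -scalerBl scaler_eq0 (negPf v0) orbF subr_eq0.
by move/eqP.
Qed.

Lemma vspace_neq0P (k : fieldType) (V : vectType k) (U : {vspace V}) :
  reflect (exists2 u, u \in U & u != 0) (U != 0%VS).
Proof.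
apply: (iffP idP) => [U0|[u uU u0]].
  by exists (vpick U); rewrite ?memv_pick ?vpick0.
by apply: contra u0 => /eqP U0; move: uU; rewrite U0 memv0.
Qed.

(** An eigenvalue of the operator f^-1 g on U, found in coordinates: f maps a
    basis of U to a basis of f @: U, and the matrix of g with respect to these
    two bases is square. *)
Lemma eigenpair (k : closedFieldType) (V W : vectType k) (f g : 'Hom(V, W))
    (U : {vspace V}) :
    U != 0%VS -> (U :&: lker f = 0)%VS -> (g @: U <= f @: U)%VS ->
  exists x u, [/\ u \in U, u != 0 & g u = x *: f u].
Proof.
move=> U0 fU gU; pose b := vbasis U; have bU := vbasisP U.
pose fb : (\dim U).-tuple W := [tuple of map f b].
have fbB : basis_of (f @: U) fb by apply: limg_basis_of.
pose A : 'M[k]_(\dim U) := \matrix_(i, j) coord fb j (g b`_i).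
have dU : (0 < \dim U)%N by rewrite lt0n dimv_eq0.
have [x xA] : exists x, eigenvalue A x.
  have /closed_rootP [x rx] : size (char_poly A) != 1.
    by rewrite size_char_poly eqSS -lt0n.
  by exists x; rewrite eigenvalue_root_char.
have /eigenvalueP [v vA v0] := xA.
have gb (i : 'I_(\dim U)) : g b`_i = \sum_j A i j *: f b`_j.
  have : g b`_i \in (f @: U)%VS.
    by apply: (subvP gU); apply/memv_img/(basis_mem bU)/mem_nth; rewrite size_tuple.
  move/(coord_basis fbB) => {1}->; apply: eq_bigr => j _.
  by rewrite mxE (nth_map 0) // size_tuple.
pose u := \sum_i v 0 i *: b`_i.
have uU : u \in U.
  by apply: memv_suml => i _; apply/memvZ/(basis_mem bU)/mem_nth; rewrite size_tuple.
exists x, u; split=> //.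
  apply: contra v0 => /eqP u0; apply/eqP/rowP => i; rewrite mxE.
  by have /freeP/(_ (v 0) u0) := basis_free bU; apply.
rewrite /u (linear_sum g) (linear_sum f) scaler_sumr /=.
transitivity (\sum_j (\sum_i v 0 i * A i j) *: f b`_j).
  rewrite (eq_bigr (fun i => \sum_j (v 0 i * A i j) *: f b`_j)).
    by rewrite exchange_big; apply: eq_bigr => j _; rewrite scaler_suml.
  by move=> i _; rewrite linearZ /= gb scaler_sumr; apply: eq_bigr => j _; rewrite scalerA.
apply: eq_bigr => j _; rewrite linearZ /= scalerA; congr (_ *: _).
by have := congr1 (fun M : 'rV_(\dim U) => M 0 j) vA; rewrite !mxE.
Qed.

Lemma noninc_stationary (h : nat -> nat) (d0 : nat) :
    (forall d, (d0 <= d)%N -> (h d.+1 <= h d)%N) ->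
  exists2 d1, (d0 <= d1)%N & forall d, (d1 <= d)%N -> h d = h d1.
Proof.
move=> hd; have [n] := ubnP (h d0); elim: n d0 hd => // n IH d0 hd hn.
have [hc|/existsNP [d /not_implyP [dd0 hdd]]] :=
  pselect (forall d, (d0 <= d)%N -> h d = h d0); first by exists d0.
have hle e : (d0 <= e)%N -> (h e <= h d0)%N.
  move=> de; rewrite -(subnKC de); elim: (e - d0)%N => [|i IHi]; first by rewrite addn0.
  by rewrite addnS (leq_trans (hd _ _)) ?leq_addr.
have [||d1 d1d hd1] := IH d.
- by move=> e de; apply: hd; apply: leq_trans de.
- have := hle _ dd0; lia.
by exists d1 => //; apply: leq_trans d1d.
Qed.

(** * Common zeros of bilinear forms *)

(** The spaces D_d stand for the duals of the homogeneous components of the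
    coordinate ring of the Segre variety, and [c i l] for the transpose of
    multiplication by the coordinate alpha_i x_l.  The ring is commutative, its
    generators satisfy the Segre relations, and it is generated in degree 1:
    these are the three hypotheses. *)
Section ContractionSystem.

Variables (k : closedFieldType) (r a : nat) (D : nat -> vectType k).
Variable c : forall d, 'I_r -> 'I_a -> 'Hom(D d.+1, D d).
Hypothesis cC : forall d i l j n (mu : D d.+2),
  c d i l (c d.+1 j n mu) = c d j n (c d.+1 i l mu).
Hypothesis c_segre : forall d i l j n (mu : D d.+2),
  c d i l (c d.+1 j n mu) = c d i n (c d.+1 j l mu).
Hypothesis c_sep : forall d (mu : D d.+1), (forall i l, c d i l mu = 0) -> mu = 0.

Definition contract d (w : 'M[k]_(r, a)) : 'Hom(D d.+1, D d) :=
  \sum_i \sum_l w i l *: c d i l.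

Lemma contractE d w mu : contract d w mu = \sum_i \sum_l w i l *: c d i l mu.
Proof.
by rewrite /contract sum_lfunE; apply: eq_bigr => i _; rewrite sum_lfunE;
  apply: eq_bigr => l _; rewrite scale_lfunE.
Qed.

Lemma contract_linear d mu : linear (fun w => contract d w mu).
Proof.
move=> x u v; rewrite !contractE scaler_sumr -big_split; apply: eq_bigr => i _ /=.
rewrite scaler_sumr -big_split; apply: eq_bigr => l _ /=.
by rewrite !mxE scalerDl scalerA.
Qed.

Lemma contract_delta d i l mu : contract d (delta_mx i l) mu = c d i l mu.
Proof.
rewrite contractE (bigD1 i) //= (bigD1 l) //= mxE !eqxx scale1r.
rewrite !big1 ?addr0 // => j ji.
  by rewrite big1 // => n _; rewrite mxE (negPf ji) scale0r.
by rewrite mxE (negPf ji) andbF scale0r.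
Qed.

Lemma contractC d u v (mu : D d.+2) :
  contract d u (contract d.+1 v mu) = contract d v (contract d.+1 u mu).
Proof.
have contract_cC w i l nu : contract d w (c d.+1 i l nu) = c d i l (contract d.+1 w nu).
  rewrite !contractE linear_sum; apply: eq_bigr => j _ /=.
  rewrite linear_sum; apply: eq_bigr => n _ /=.
  by rewrite linearZ /= cC.
rewrite (contractE v) linear_sum contractE; apply: eq_bigr => i _ /=.
rewrite linear_sum; apply: eq_bigr => l _ /=.
by rewrite linearZ /= contract_cC.
Qed.

(** In degree d this is the dual of the quotient of the coordinate ring by the
    ideal of [ws].  The ideal has no element of degree 0, whence [fullv]. *)
Definition killed (ws : seq 'M[k]_(r, a)) d : {vspace D d} :=
  match d with
  | 0 => fullv
  | d'.+1 => (\bigcap_(w <- ws) lker (contract d' w))%VS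
  end.

Lemma killed_cons w ws d :
  killed (w :: ws) d.+1 = (lker (contract d w) :&: killed ws d.+1)%VS.
Proof. exact: big_cons. Qed.

Lemma killedP ws d (mu : D d.+1) :
  reflect (forall w, w \in ws -> contract d w mu = 0) (mu \in killed ws d.+1).
Proof.
apply: (iffP idP) => [|h].
  elim: ws => // w ws IH; rewrite killed_cons memv_cap memv_ker => /andP [/eqP w0 /IH h] v.
  by rewrite inE => /predU1P [->|/h].
elim: ws h => [|w ws IH] h; first by rewrite /= big_nil memvf.
rewrite killed_cons memv_cap memv_ker h ?mem_head ?eqxx //=.
by apply: IH => v vw; rewrite h // inE vw orbT.
Qed.

Lemma killed_span ws d mu w :
  mu \in killed ws d.+1 -> w \in <<ws>>%VS -> contract d w mu = 0.
Proof.
move=> muK wS; pose f : 'Hom('M[k]_(r, a), D d) := linfun (fun w => contract d w mu).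
have fE v : f v = contract d v mu by rewrite linfun_linearE //; apply: contract_linear.
apply/eqP; rewrite -fE -memv_ker; move: wS; apply/subvP/span_subvP => v vw.
by rewrite memv_ker fE (killedP _ _ muK).
Qed.

Lemma contract_killed ws w d mu :
  mu \in killed ws d.+1 -> contract d w mu \in killed ws d.
Proof.
case: d mu => [|d] mu muK; first exact: memvf.
by apply/killedP => v vw; rewrite contractC (killedP _ _ muK) // linear0.
Qed.

(** A quotient ring generated in degree 1 that vanishes in some degree vanishes
    in all larger ones. *)
Lemma killed_neq0_pred ws d : killed ws d.+1 != 0%VS -> killed ws d != 0%VS.
Proof.
case/vspace_neq0P => mu muK mu0; apply/vspace_neq0P; apply: contrapT => /forallPNP h.
case/eqP: mu0; apply: c_sep => i l; rewrite -contract_delta; apply/eqP.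
have := h _ (contract_killed (delta_mx i l) muK).
by move/negP; rewrite negbK.
Qed.

Lemma killed_neq0_le ws d e :
  (d <= e)%N -> killed ws e != 0%VS -> killed ws d != 0%VS.
Proof.
move=> de; rewrite -(subnKC de); elim: (e - d)%N => [|n IH]; first by rewrite addn0.
by rewrite addnS => /killed_neq0_pred.
Qed.

(** Rank-nullity for contraction by [w]: its kernel is the first summand, and it
    maps into the second. *)
Lemma dim_killed_step w ws d :
  (\dim (killed ws d.+1) <= \dim (killed (w :: ws) d.+1) + \dim (killed ws d))%N.
Proof.
rewrite -(limg_ker_dim (contract d w) (killed ws d.+1)) killed_cons [in leqRHS]capvC leq_add2l.
apply: dimvS; apply/subvP => _ /memv_imgP [mu muK ->].
exact: contract_killed.
Qed.

(** The ideal of [ws] contains no power of the irrelevant ideal. *)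
Definition persistent ws := forall d, killed ws d != 0%VS.

(** Summing [dim_killed_step] over d raises the order of growth by at most one
    for each form that is dropped. *)
Lemma dim_killed_growth us vs C i :
    (forall d, (\dim (killed (us ++ vs) d) <= C * d.+1 ^ i)%N) ->
  exists C', forall d, (\dim (killed vs d) <= C' * d.+1 ^ (i + size us))%N.
Proof.
elim: us C i => [|w us IH] C i /= h; first by exists C => d; rewrite addn0.
rewrite addnS -addSn; apply: (IH (C + \dim (killed (us ++ vs) 0))%N) => d.
elim: d => [|d IHd]; first by rewrite exp1n muln1 leq_addl.
apply: leq_trans (dim_killed_step w _ _) _.
apply: leq_trans (leq_add (h _) IHd) _.
rewrite !expnS; set x := \dim _.
have : (d.+1 ^ i <= d.+2 ^ i)%N by case: (i) => // n; rewrite leq_exp2r.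
move: (d.+1 ^ i)%N (d.+2 ^ i)%N => y z yz.
rewrite [(d.+2 * z)%N]mulSn mulnDr leq_add //; last by rewrite !leq_mul.
by rewrite leq_mul ?leq_addr.
Qed.

(** When [w :: us] kills no nonzero vector of large degree, [dim_killed_step]
    makes the dimensions for [us] bounded; dropping the forms of [us] one by one
    then bounds the growth of D_d itself. *)
Lemma nonpersistent_growth ws :
    (forall d, {:D d}%VS != 0%VS) -> ~ persistent ws ->
  exists2 C, (0 < size ws)%N &
    forall d, (\dim {:D d} <= C * d.+1 ^ (size ws).-1)%N.
Proof.
move=> D0 /existsNP [d0 /negP]; rewrite negbK => Kd0.
have Kd d : (d0 <= d)%N -> killed ws d = 0%VS.
  by move=> dd; apply/eqP; apply: contraLR Kd0 => /(killed_neq0_le dd).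
case: ws {Kd0} Kd => [|w us] Kd.
  by have := D0 d0.+1; have := Kd d0.+1 (leqnSn _); rewrite /= big_nil => ->; rewrite eqxx.
have us_bounded d : (\dim (killed us d) <= (\sum_(e < d0.+1) \dim (killed us e)) * d.+1 ^ 0)%N.
  rewrite expn0 muln1; have [dd|dd] := leqP d d0.
    by rewrite (bigD1 (Ordinal (dd : (d < d0.+1)%N))) //= leq_addr.
  apply: (@leq_trans (\dim (killed us d0))); last by rewrite (bigD1 ord_max) //= leq_addr.
  rewrite -(subnKC (ltnW dd)); elim: (d - d0)%N => [|n IH]; first by rewrite addn0.
  rewrite addnS; apply: leq_trans (dim_killed_step w _ _) _.
  by rewrite Kd ?dimv0 // -addnS leq_addr.
have [|C hC] := @dim_killed_growth us [::] (\sum_(e < d0.+1) \dim (killed us e)) 0.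
  by rewrite cats0.
exists C => // d; case: d => [|d]; first exact: hC.
by have := hC d.+1; rewrite /= big_nil add0n.
Qed.

Lemma maximal_persistent ws : persistent ws ->
  exists2 vs, {subset ws <= <<vs>>%VS} &
    persistent vs /\ forall w, persistent (w :: vs) -> w \in <<vs>>%VS.
Proof.
have [n] := ubnP (\dim {:'M[k]_(r, a)} - \dim <<ws>>%VS)%N.
elim: n ws => // n IH ws wsn wsP.
have [hmax|/existsNP [w /not_implyP [wP /negP wS]]] :=
  pselect (forall w, persistent (w :: ws) -> w \in <<ws>>%VS).
  by exists ws => //; apply: memv_span.
have sub : (<<ws>> <= <<w :: ws>>)%VS by rewrite span_cons addvSr.
have lt : (\dim <<ws>> < \dim <<w :: ws>>)%N.
  rewrite (ltn_leqif (dimv_leqif_sup sub)); apply: contra wS => /subvP; apply.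
  by rewrite memv_span ?mem_head.
have [||vs wvs hvs] := IH (w :: ws) => //.
  rewrite -ltnS; apply: leq_trans wsn; rewrite ltnS; apply: ltn_sub2l (lt).
  exact: leq_trans lt (dimvS (subvf _)).
by exists vs => // v vw; apply: wvs; rewrite inE vw orbT.
Qed.

(** For a maximal persistent [vs], a form z outside its span acts injectively,
    hence bijectively, on the killed spaces of large degree.  An eigenvalue x of
    z^-1 w gives a form w - x z that annihilates a nonzero vector, and lifting
    this vector along z shows that adding w - x z to [vs] preserves persistence.
    So w - x z is in the span of [vs]: every form is proportional to z modulo
    this span.  The proportionality factors of the coordinates are a rank one
    matrix because of the Segre relations. *)
Lemma persistent_zero ws : persistent ws ->
  exists (alpha : 'rV[k]_r) (x : 'rV[k]_a), [/\ alpha != 0, x != 0 &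
    forall w : 'M[k]_(r, a), w \in ws -> \sum_i \sum_l w i l * (alpha 0 i * x 0 l) = 0].
Proof.
case/maximal_persistent => vs wsvs [vsP vs_max].
have all_killed d (mu : D d.+1) : (forall w, contract d w mu = 0) -> mu = 0.
  by move=> h; apply: c_sep => i l; rewrite -contract_delta.
have [z zvs] : exists z, z \notin <<vs>>%VS.
  apply: contrapT => /forallNP h; have /vspace_neq0P [mu muK /eqP[]] := vsP 1%N.
  apply: all_killed => w; apply: killed_span muK _.
  by have /negP := h w; rewrite negbK.
have [d0 Kz] : exists d0, killed (z :: vs) d0 = 0%VS.
  apply: contrapT => /forallNP h; case/negP: zvs; apply: vs_max => d.
  by apply/eqP/h.
have Kz' d : (d0 <= d)%N -> killed (z :: vs) d = 0%VS.
  by move=> dd; apply/eqP; apply: contra_eqT Kz => /(killed_neq0_le dd).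
have z_inj d mu : (d0 <= d)%N -> mu \in killed vs d.+1 -> contract d z mu = 0 -> mu = 0.
  move=> dd muK zmu; apply/eqP; rewrite -memv0 -(Kz' d.+1 (leqW dd)) killed_cons.
  by rewrite memv_cap memv_ker zmu eqxx.
have dim_z d : (d0 <= d)%N -> \dim (contract d z @: killed vs d.+1) = \dim (killed vs d.+1).
  by move=> dd; apply: limg_dim_eq; rewrite capvC -killed_cons Kz' // leqW.
have z_img d : (contract d z @: killed vs d.+1 <= killed vs d)%VS.
  by apply/subvP => _ /memv_imgP [mu muK ->]; apply: contract_killed.
have [|d1 d01 hd1] := @noninc_stationary (fun d => \dim (killed vs d)) d0.
  by move=> d dd; rewrite -dim_z ?dimvS.
have z_surj d : (d1 <= d)%N -> (contract d z @: killed vs d.+1)%VS = killed vs d.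
  move=> dd; apply/eqP; rewrite eqEdim z_img dim_z ?(leq_trans d01) //.
  by rewrite (hd1 d) // (hd1 d.+1) ?leqW //=.
have [lam lamP] : exists lam : 'M[k]_(r, a) -> k, forall w, w - lam w *: z \in <<vs>>%VS.
  suff : forall w, exists x : k, w - x *: z \in <<vs>>%VS by move=> /choice [f fP]; exists f.
  move=> w.
  have [||x [mu [muK mu0 wmu]]] :=
    @eigenpair k _ _ (contract d1 z) (contract d1 w) (killed vs d1.+1) (vsP _).
  - by rewrite capvC -killed_cons Kz' // leqW.
  - by rewrite z_surj //; apply/subvP => _ /memv_imgP [mu muK ->]; apply: contract_killed.
  exists x; set w' := w - x *: z; apply: vs_max.
  (* Lifting along z: if xi maps to nu, then w' xi is killed by z, so it is 0. *)
  have big n : killed (w' :: vs) (n + d1).+1 != 0%VS.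
    elim: n => [|n /vspace_neq0P [nu]]; last first.
      rewrite killed_cons memv_cap memv_ker => /andP [/eqP w'nu nuK] nu0.
      have : nu \in (contract (n + d1).+1 z @: killed vs (n + d1).+2)%VS.
        by rewrite z_surj // leqW ?leq_addl.
      case/memv_imgP => xi xiK nuE; apply/vspace_neq0P; exists xi.
        rewrite (@killed_cons w' vs (n + d1).+1) memv_cap memv_ker xiK andbT; apply/eqP.
        apply: (@z_inj (n + d1)%N); rewrite ?contract_killed ?(leq_trans d01) ?leq_addl //.
        by rewrite contractC -nuE.
      by apply: contra nu0 => /eqP xi0; rewrite nuE xi0 linear0.
    rewrite add0n; apply/vspace_neq0P; exists mu => //.
    rewrite killed_cons memv_cap muK memv_ker andbT.
    have -> : w' = (- x) *: z + w by rewrite addrC scaleNr.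
    by rewrite (contract_linear mu) scaleNr wmu addrC subrr.
  move=> d; apply: (@killed_neq0_le _ d (d + d1).+1); last exact: big.
  by rewrite leqW ?leq_addr.
have lamE d mu w : mu \in killed vs d.+1 -> contract d w mu = lam w *: contract d z mu.
  move=> muK; have := killed_span muK (lamP w).
  rewrite -scaleNr addrC (contract_linear mu) scaleNr => /eqP.
  by rewrite addrC subr_eq0 => /eqP.
(* Degree 2 is where the Segre relations live. *)
have /vspace_neq0P [mu muK mu0] := vsP 2%N.
pose nu := contract 1 z mu; pose tau := contract 0 z nu.
have nuK : nu \in killed vs 1 by apply: contract_killed.
have nu0 : nu != 0.
  apply: contra mu0 => /eqP nu0; apply/eqP/all_killed => w.
  by rewrite lamE // -/nu nu0 scaler0.
have tau0 : tau != 0.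
  apply: contra nu0 => /eqP tau0; apply/eqP/all_killed => w.
  by rewrite lamE // -/tau tau0 scaler0.
pose m (i : 'I_r) (l : 'I_a) := lam (delta_mx i l).
have cmu i l : c 1 i l mu = m i l *: nu by rewrite -contract_delta lamE.
have cnu i l : c 0 i l nu = m i l *: tau by rewrite -contract_delta lamE.
have rank1 (i j : 'I_r) (l n : 'I_a) : m i l * m j n = m i n * m j l.
  apply: (scale_inj tau0); have := c_segre j n i l mu; rewrite !cmu !linearZ /= !cnu !scalerA.
  by move=> ->.
have [i0 [l0 m0]] : exists i l, m i l != 0.
  apply: contrapT => h; case/eqP: mu0; apply: c_sep => i l; rewrite cmu.
  have [->|mil] := eqVneq (m i l) 0; first by rewrite scale0r.
  by case: h; exists i, l.
exists (\row_i m i l0), (\row_l m i0 l); split.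
- by apply: contra m0 => /eqP/rowP/(_ i0); rewrite !mxE => ->.
- by apply: contra m0 => /eqP/rowP/(_ l0); rewrite !mxE => ->.
move=> w ww; have := killed_span muK (wsvs _ ww).
rewrite contractE => sum0; have {}sum0 : \sum_(i < r) \sum_(l < a) w i l * m i l = 0.
  apply: (scale_inj nu0); rewrite scale0r -[RHS]sum0 scaler_suml.
  apply: eq_bigr => i _; rewrite scaler_suml. apply: eq_bigr => l _.
  by rewrite cmu scalerA.
transitivity (m i0 l0 * (\sum_(i < r) \sum_(l < a) w i l * m i l)).
  2: by rewrite sum0 mulr0.
rewrite mulr_sumr; apply: eq_bigr => i _.
rewrite mulr_sumr; apply: eq_bigr => l _.
by rewrite !mxE (rank1 i i0 l0 l) mulrA mulrC.
Qed.

End ContractionSystem.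

(** * The Segre coordinate ring *)

Section Words.

Variable n : nat.

(** A monomial of degree d in n variables, as the sorted list of its factors. *)
Definition word d := {t : d.-tuple 'I_n | sorted leq (map val t)}.

Let ord_le : rel 'I_n := relpre val leq.

Lemma insert_subproof d (i : 'I_n) (t : word d) :
  sorted leq (map val (sort_tuple ord_le [tuple of i :: val t])).
Proof. by rewrite sorted_map; apply: sort_sorted => x y; apply: leq_total. Qed.

(** Multiplication of a monomial by a variable. *)
Definition insert d (i : 'I_n) (t : word d) : word d.+1 :=
  exist _ (sort_tuple ord_le [tuple of i :: val t]) (insert_subproof i t).

Lemma perm_insert d i (t : word d) s :
  perm_eq (val (insert i t)) s = perm_eq (i :: val t) s.
Proof. exact: (perm_sort ord_le (i :: val t) s). Qed.

Lemma word_perm_inj d (t u : word d) : perm_eq (val t) (val u) -> t = u.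
Proof.
move=> tu; apply/val_inj/val_inj; apply: (@sorted_eq _ ord_le) => //.
- by move=> x y z; apply: leq_trans.
- by move=> x y /anti_leq /val_inj.
- by have := valP t; rewrite sorted_map.
- by have := valP u; rewrite sorted_map.
Qed.

Lemma insertC d i j (t : word d) : insert i (insert j t) = insert j (insert i t).
Proof.
have perm2 i' j' : perm_eq (val (insert i' (insert j' t))) [:: i', j' & val t].
  by rewrite perm_insert perm_cons perm_insert.
apply: word_perm_inj; apply: perm_trans (perm2 i j) _; rewrite perm_sym.
by apply: perm_trans (perm2 j i) _; apply/permPl/(perm_catCA [:: j] [:: i]).
Qed.

Lemma insert_surj d (t : word d.+1) : exists i u, t = insert i u.
Proof.
case: t => t tP; case/tupleP: t tP => i u tP.
have uP : sorted leq (map val u) by apply: path_sorted tP.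
exists i, (exist _ u uP); apply: word_perm_inj.
by rewrite perm_sym perm_insert.
Qed.

End Words.

Lemma card_word n d : #|{: word n.+1 d}| = 'C(d + n, d).
Proof. by rewrite card_sig -card_sorted_tuples cardsE. Qed.

Lemma expn_le_binomial n d : (d.+1 ^ n <= 'C(d + n, d) * n`!)%N.
Proof.
have -> : 'C(d + n, d) = 'C(d + n, n) by rewrite -bin_sub ?leq_addr // addKn.
rewrite bin_ffact; elim: n => [|n IH]; first by rewrite expn0 addn0 ffactn0.
by rewrite addnS ffactSS expnS leq_mul // ltnS leq_addr.
Qed.

Section SegreModel.

Variables (k : closedFieldType) (p m : nat).

(** The dual of the forms of bidegree (d, d), given by the values on monomials. *)
Definition bisym d : vectType k := {ffun word p.+1 d * word m.+1 d -> k^o}.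

Definition bisym_contract d (i : 'I_p.+1) (l : 'I_m.+1) : 'Hom(bisym d.+1, bisym d) :=
  linfun (fun mu : bisym d.+1 =>
    [ffun t : word p.+1 d * word m.+1 d => mu (insert i t.1, insert l t.2)] : bisym d).

Lemma bisym_contractE d i l mu (t : word p.+1 d * word m.+1 d) :
  bisym_contract d i l mu t = mu (insert i t.1, insert l t.2).
Proof.
rewrite /bisym_contract linfun_linearE ?ffunE //.
by move=> x u v; apply/ffunP => s; rewrite !ffunE.
Qed.

Lemma dim_bisym d : \dim {:bisym d} = ('C(d + p, d) * 'C(d + m, d))%N.
Proof. by rewrite dimvf /dim /= card_prod !card_word muln1. Qed.

(** If the forms had no common zero, dim D_d would be bounded by a multiple of
    (d + 1)^(p + m - 1), whereas it is at least a multiple of (d + 1)^(p + m). *)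
Theorem bilinear_zero (ws : seq 'M[k]_(p.+1, m.+1)) : (size ws <= p + m)%N ->
  exists (alpha : 'rV[k]_p.+1) (x : 'rV[k]_m.+1), [/\ alpha != 0, x != 0 &
    forall w, w \in ws -> \sum_i \sum_l w i l * (alpha 0 i * x 0 l) = 0].
Proof.
move=> ws_size.
have cC d i l j n (mu : bisym d.+2) :
    bisym_contract d i l (bisym_contract d.+1 j n mu) =
    bisym_contract d j n (bisym_contract d.+1 i l mu).
  by apply/ffunP => t; rewrite !bisym_contractE /= insertC [insert n _]insertC.
have c_segre d i l j n (mu : bisym d.+2) :
    bisym_contract d i l (bisym_contract d.+1 j n mu) =
    bisym_contract d i n (bisym_contract d.+1 j l mu).
  by apply/ffunP => t; rewrite !bisym_contractE /= [insert n _]insertC.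
have c_sep d (mu : bisym d.+1) :
    (forall i l, bisym_contract d i l mu = 0) -> mu = 0.
  move=> h; apply/ffunP => -[u v].
  have [i [u' ->]] := insert_surj u; have [l [v' ->]] := insert_surj v.
  by have /ffunP/(_ (u', v')) := h i l; rewrite bisym_contractE !ffunE.
apply: (persistent_zero cC c_segre c_sep); apply: contrapT => np.
have D0 d : {:bisym d}%VS != 0%VS.
  by rewrite -dimv_eq0 dim_bisym muln_eq0 negb_or -!lt0n !bin_gt0 !leq_addr.
have [C ws0 hC] := nonpersistent_growth cC c_sep D0 np.
set F := (C * (p`! * m`!))%N.
have := hC F; rewrite dim_bisym => le1.
have le2 : (F.+1 ^ (p + m) <= F * F.+1 ^ (size ws).-1)%N.
  rewrite expnD; apply: leq_trans (leq_mul (expn_le_binomial _ _) (expn_le_binomial _ _)) _.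
  rewrite mulnACA; apply: leq_trans (leq_mul le1 (leqnn _)) _.
  by rewrite mulnAC.
have le3 : (F.+1 * F.+1 ^ (size ws).-1 <= F.+1 ^ (p + m))%N.
  by rewrite -expnS prednK // leq_pexp2l.
have := leq_trans le3 le2; rewrite leq_pmul2r ?expn_gt0 //; lia.
Qed.

End SegreModel.

(** The coordinates of the map k^r x M_1 -> M_2 are b bilinear forms, and a
    common zero (alpha, x) of them is a vector x in the kernel of M^alpha. *)
Lemma EKP_dim (k : closedFieldType) (r : nat) (M : kronecker_rep k r) :
  (0 < r)%N -> (0 < (dim_vector M).1)%N -> EKP M ->
  ((dim_vector M).1 + r <= (dim_vector M).2 + 1)%N.
Proof.
case: r M => // p M _ /= + ekp; case mE : (\dim {:rep1 M}) => [//|m] _.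
rewrite addnS addn1 ltnS leqNgt; apply/negP => small.
have [e eB] : exists e : m.+1.-tuple (rep1 M), basis_of fullv e.
  by rewrite -mE; exists (vbasis fullv); apply: vbasisP.
pose f := vbasis {:rep2 M}.
pose form j : 'M[k]_(p.+1, m.+1) := \matrix_(i, l) coord f j (rep_arrow M i e`_l).
have [|alpha [x [a0 x0 h]]] := @bilinear_zero k p m [seq form j | j : 'I_(\dim {:rep2 M})].
  by rewrite size_image card_ord; lia.
pose v := \sum_l x 0 l *: e`_l.
have combE : rep_comb M alpha v = 0.
  rewrite [LHS](coord_vbasis (memvf _)); apply: big1 => j _.
  rewrite -/f (_ : coord f j _ = 0) ?scale0r //.
  have jf : form j \in [seq form j | j : 'I_(\dim {:rep2 M})] by exact: codom_f.
  transitivity (\sum_i \sum_l form j i l * (alpha 0 i * x 0 l)); last exact: h.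
  rewrite /rep_comb sum_lfunE linear_sum.
  apply: eq_bigr => i _; rewrite scale_lfunE linearZ /= /v !linear_sum mulr_sumr /=.
  apply: eq_bigr => l _; rewrite !linearZ /= mxE; ring.
have := ekp _ a0; move/eqP; rewrite -subv0 => /subvP /(_ v).
rewrite memv_ker combE eqxx memv0 => /(_ isT) /eqP v0.
case/negP: x0; apply/eqP/rowP => l; rewrite mxE.
by have /freeP/(_ (x 0) v0) := basis_free eB; apply.
Qed.

(** * Reflection at the sink *)

Lemma kronecker_form_le1 (r a b : nat) :
  (kronecker_form r a%:Z b%:Z <= 1) = (a * a + b * b <= r * a * b + 1)%N.
Proof. by rewrite /kronecker_form !expr2; apply/idP/idP; lia. Qed.

Section Representations.

Variables (k : fieldType) (r : nat).
Implicit Types (M L : kronecker_rep k r) (X Y : vectType k).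

Lemma daddv_pi_compl X (U W : {vspace X}) x :
  (U + W = fullv)%VS -> (U :&: W = 0)%VS -> daddv_pi U W x + daddv_pi W U x = x.
Proof. by move=> UWf UW0; apply: daddv_pi_add => //; rewrite UWf memvf. Qed.

Definition sum_arrows M (x : {ffun 'I_r -> rep1 M}) : rep2 M :=
  \sum_i rep_arrow M i (x i).

Lemma sum_arrows_linear M : linear (@sum_arrows M).
Proof.
move=> c x y; rewrite scaler_sumr -big_split; apply: eq_bigr => i _.
by rewrite !ffunE linearP.
Qed.

Lemma sum_arrows_sub M (U : {vspace rep1 M}) (V : {vspace rep2 M}) (x : {ffun 'I_r -> rep1 M}) :
  subrep U V -> (forall i, x i \in U) -> sum_arrows x \in V.
Proof.
move=> sUV xU; apply: memv_suml => i _; apply: (subvP (sUV i)).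
exact: memv_img.
Qed.

Lemma memv_sum_img M (U : {vspace rep1 M}) y :
  y \in (\sum_i rep_arrow M i @: U)%VS ->
  exists2 x : {ffun 'I_r -> rep1 M}, (forall i, x i \in U) & y = sum_arrows x.
Proof.
case/memv_sumP => z zU ->; pose P i u := u \in U /\ z i = rep_arrow M i u.
have /choice [x xP] : forall i, exists u, P i u.
  by move=> i; have /memv_imgP [u uU zE] := zU i isT; exists u.
exists [ffun i => x i] => [i|]; first by rewrite ffunE; case: (xP i).
by apply: eq_bigr => i _; rewrite ffunE; case: (xP i).
Qed.

(** A complement of the image would split off as a sum of copies of the simple
    representation at the sink. *)
Lemma sum_arrows_surj M y :
  indecomposable M -> (dim_vector M).1 <> 0%N -> exists x, y = @sum_arrows M x.
Proof.
case=> _ ind a0; pose I := (\sum_i rep_arrow M i @: fullv)%VS.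
suff IC0 : (I^C = 0)%VS.
  have : y \in I by have := addv_complf I; rewrite IC0 addv0 => ->; apply: memvf.
  by case/memv_sum_img => x _ ->; exists x.
case: (ind fullv I 0%VS (I^C)%VS) => [||[]//].
  split; rewrite ?addv0 ?capv0 ?addv_complf ?capv_compl //.
  - by move=> i; rewrite /I (bigD1 i) //= addvSl.
  - by move=> i; rewrite limg0 sub0v.
by case=> f0 _; case: a0; rewrite /dim_vector f0 dimv0.
Qed.

Section Reflect.

Variable M : kronecker_rep k r.

Definition syzygies : {vspace {ffun 'I_r -> rep1 M}} := lker (linfun (@sum_arrows M)).

Lemma memv_syzygies x : (x \in syzygies) = (sum_arrows x == 0).
Proof. by rewrite memv_ker linfun_linearE //; apply: sum_arrows_linear. Qed.

Definition sink_reflection : kronecker_rep k r :=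
  KroneckerRep (fun i => linfun (fun x : subvs_of syzygies => vsval x i)).

Lemma sink_reflectionE i (x : rep1 sink_reflection) : rep_arrow sink_reflection i x = vsval x i.
Proof. by rewrite [LHS]linfun_linearE // => c u v; rewrite linearP !ffunE. Qed.

Hypotheses (M_ind : indecomposable M) (M1_neq0 : (dim_vector M).1 <> 0%N).

Lemma dim_sink_reflection : (dim_vector sink_reflection).2 = (dim_vector M).1 /\
  ((dim_vector sink_reflection).1 + (dim_vector M).2 = r * (dim_vector M).1)%N.
Proof.
split=> //=.
have <- : (limg (linfun (@sum_arrows M)) = fullv)%VS.
  apply/vspaceP => y; rewrite memvf.
  have [x ->] := sum_arrows_surj y M_ind M1_neq0.
  by rewrite -(linfun_linearE (@sum_arrows_linear M)) memv_img ?memvf.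
rewrite dimvf /dim /= -[X in (X + _)%N]/(\dim syzygies) -(capfv syzygies) limg_ker_dim.
by rewrite !dimvf /dim /= card_ord.
Qed.

(** A decomposition (U1, U2), (W1, W2) of the reflection makes the kernel of
    M_1^r -> M_2 the sum of its parts in U2^r and in W2^r; so the images of U2^r
    and W2^r in M_2 meet in 0, and with U2 and W2 they decompose M. *)
Lemma sink_reflection_indecomposable : indecomposable sink_reflection.
Proof.
split=> [[_]|U1 U2 W1 W2 [sU sW [UW1f UW10] [UW2f UW20]]]; first exact: M1_neq0.
have zero1 (A1 : {vspace rep1 sink_reflection}) A2 : subrep A1 A2 -> A2 = 0%VS -> A1 = 0%VS.
  move=> sA A20; apply/eqP; rewrite -subv0; apply/subvP => u uA.
  rewrite memv0 -(inj_eq val_inj); apply/eqP/ffunP => i.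
  rewrite ffunE -[LHS]sink_reflectionE; apply/eqP; rewrite -memv0 -A20.
  by apply: (subvP (sA i)); apply: memv_img.
pose img A := (\sum_i rep_arrow M i @: A)%VS.
have sub_img A : subrep A (img A).
  by move=> i; rewrite /img (bigD1 i) //= addvSl.
case: (M_ind.2 U2 (img U2) W2 (img W2)) => [|[U20 _]|[W20 _]].
- split=> //; split.
    rewrite /img -big_split /=; apply/vspaceP => y; rewrite memvf.
    have [x ->] := sum_arrows_surj y M_ind M1_neq0.
    apply: memv_suml => i _; apply: (subvP (sumv_sup i _ (subvv _))) => //.
    by rewrite -limgD UW2f memv_img ?memvf.
  apply/eqP; rewrite -subv0; apply/subvP => y; rewrite memv_cap memv0 => /andP [].
  case/memv_sum_img => u uU -> /memv_sum_img [w wW uw].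
  have uwS : u - w \in syzygies.
    rewrite memv_syzygies (_ : u - w = -1 *: w + u); last by rewrite scaleN1r addrC.
    by rewrite sum_arrows_linear scaleN1r uw addNr.
  have : Subvs uwS \in (U1 + W1)%VS by rewrite UW1f memvf.
  case/memv_addP => u1 u1U [w1 w1W /(congr1 val) /= /ffunP uwE].
  have comp A1 A2 (v : rep1 sink_reflection) i : subrep A1 A2 -> v \in A1 -> vsval v i \in A2.
    by move=> sA vA; rewrite -sink_reflectionE; apply/(subvP (sA i))/memv_img.
  suff uE : u = vsval u1 by rewrite uE -memv_syzygies subvsP.
  apply/ffunP => i; apply/eqP; rewrite -subr_eq0 -memv0 -UW20 memv_cap.
  rewrite rpredB ?uU ?(comp U1) //=.
  have -> : u i - vsval u1 i = w i + vsval w1 i.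
    have := uwE i; rewrite !ffunE => /eqP; rewrite subr_eq => /eqP ->.
    by rewrite [RHS]addrC addrAC [vsval u1 i + _]addrC addrK.
  by rewrite rpredD ?wW ?(comp W1).
- by left; split=> //; apply: zero1 sU U20.
- by right; split=> //; apply: zero1 sW W20.
Qed.

End Reflect.
End Representations.

Section Form.

Variables (k : fieldType) (r : nat).
Implicit Types (M L : kronecker_rep k r) (X Y : vectType k).

Lemma indecomposable_dim1_0 M :
  indecomposable M -> (dim_vector M).1 = 0%N -> (dim_vector M).2 = 1%N.
Proof.
case=> d0 ind /= a0; have M1_0 : {:rep1 M}%VS = 0%VS by apply/eqP; rewrite -dimv_eq0 a0.
have A0 (A : {vspace rep1 M}) : A = 0%VS by apply/eqP; rewrite -subv0 -M1_0 subvf.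
have sub0 A (B : {vspace rep2 M}) : subrep A B by move=> i; rewrite (A0 A) limg0 sub0v.
have M2_0 : {:rep2 M}%VS != 0%VS.
  by apply/eqP => M2_0; case: d0; rewrite /dim_vector M1_0 M2_0 !dimv0.
case/vspace_neq0P: M2_0 => v _ v0.
case: (ind 0%VS <[v]>%VS 0%VS (<[v]>^C)%VS) => [|[_]|[_ vC]].
- by split=> //; rewrite ?addv_complf ?capv_compl ?cap0v ?M1_0 ?addv0.
- by move=> v_0; case/negP: v0; rewrite -memv0 -v_0 memv_line.
- by have := addv_complf <[v]>%VS; rewrite vC addv0 /= => <-; rewrite dim_vline v0.
Qed.

(** Descent on a = dim M_1 by the reflection, which replaces (a, b) by
    (c, a) with c = r a - b and preserves the form.  If c >= a, then
    q(a, b) = a^2 - b c <= 0 outright. *)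
Lemma indecomposable_form M :
  indecomposable M -> ((dim_vector M).1 < (dim_vector M).2)%N ->
  kronecker_form r (dim_vector M).1%:Z (dim_vector M).2%:Z <= 1.
Proof.
have [n] := ubnP (dim_vector M).1; elim: n M => // n IH M aM M_ind ab.
rewrite kronecker_form_le1.
have [a0|/eqP a0] := eqVneq (dim_vector M).1 0%N.
  by rewrite a0 (indecomposable_dim1_0 M_ind a0) !muln0.
have [b' a'] := dim_sink_reflection M_ind a0.
have := IH _ _ (sink_reflection_indecomposable M_ind a0); rewrite kronecker_form_le1 b'.
move: (dim_vector (sink_reflection M)).1 (dim_vector M).1 (dim_vector M).2 aM ab a0 a'.
move=> c a b an ab a0 cE.
rewrite -cE (_ : (r * c * a = c * (c + b))%N); last by rewrite cE mulnAC mulnC.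
have [ca|ac] := ltnP c a; last by move=> _; nia.
by move=> /(_ _ isT); have -> : (c < n)%N by [lia|]; move/(_ isT); nia.
Qed.

Lemma dual_orthogonal (r2 : (1 < r)%N) (alpha : 'rV[k]_r) : exists2 beta : 'rV[k]_r,
  alpha != 0 -> beta != 0 & \sum_i beta 0 i * alpha 0 i = 0.
Proof.
have [->|a0] := eqVneq alpha 0.
  by exists 0 => [/eqP//|]; apply: big1 => i _; rewrite mxE mul0r.
have [i ai] : exists i, alpha 0 i != 0.
  apply/existsP; rewrite -negb_forall; apply: contra a0 => /forallP h.
  by apply/eqP/rowP => i; rewrite mxE; apply/eqP.
have [j ji] : exists j : 'I_r, j != i.
  have [i0|i0] := eqVneq (i : nat) 0%N.
    by exists (Ordinal r2); rewrite -val_eqE /= i0.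
  by exists (Ordinal (ltnW r2)); rewrite -val_eqE /= eq_sym.
exists (alpha 0 j *: delta_mx 0 i - alpha 0 i *: delta_mx 0 j) => [_|].
  apply: contra ai => /eqP/rowP/(_ j).
  by rewrite !mxE eqxx (negPf ji) /= eqxx mulr0 mulr1 sub0r => /eqP; rewrite oppr_eq0.
rewrite (bigD1 i) //= (bigD1 j) //= big1 => [|l /andP [li lj]].
  rewrite !mxE !eqxx (negPf ji) eq_sym (negPf ji) /=; ring.
rewrite !mxE (negPf li) (negPf lj) /=; ring.
Qed.

(** * Representations X -> X^r / N *)

(** The quotient of X^r is given by a linear map [pi] out of X^r. *)
Section Copresentation.

Variables (X Y : vectType k) (pi : 'Hom({ffun 'I_r -> X}, Y)).

Definition single (i : 'I_r) (x : X) : {ffun 'I_r -> X} :=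
  [ffun j => if j == i then x else 0].

Definition copresent : kronecker_rep k r :=
  KroneckerRep (fun i => linfun (fun x : X => pi (single i x))).

Lemma copresentE i x : rep_arrow copresent i x = pi (single i x).
Proof.
rewrite [LHS]linfun_linearE // => c u v; rewrite -linearP; congr (pi _).
by apply/ffunP => j; rewrite !ffunE; case: eqP => // _; rewrite scaler0 addr0.
Qed.

Lemma sum_copresent (x : {ffun 'I_r -> X}) : sum_arrows (M := copresent) x = pi x.
Proof.
rewrite /sum_arrows (eq_bigr (fun i => pi (single i (x i)))) => [|i _].
  rewrite -linear_sum; congr (pi _); apply/ffunP => j; rewrite sum_ffunE (bigD1 j) //=.
  rewrite ffunE eqxx big1 ?addr0 // => i ij.
  by rewrite ffunE eq_sym (negPf ij).
exact: copresentE.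
Qed.

Lemma comb_copresent alpha x :
  rep_comb copresent alpha x = pi [ffun i => alpha 0 i *: x].
Proof.
rewrite -sum_copresent /rep_comb sum_lfunE; apply: eq_bigr => i _.
by rewrite ffunE scale_lfunE linearZ.
Qed.

Lemma copresent_EKP :
  (forall (alpha : 'rV[k]_r) (x : X), alpha != 0 ->
    [ffun i => alpha 0 i *: x] \in lker pi -> x = 0) ->
  EKP copresent.
Proof.
move=> h alpha a0; apply/eqP; rewrite -subv0; apply/subvP => x.
rewrite memv_ker comb_copresent -memv_ker memv0 => /(h _ _ a0) ->.
exact: eqxx.
Qed.

(** If (U1, U2), (W1, W2) decompose the representation and x = u + w is in
    ker pi with u in U1^r and w in W1^r, then pi u = - pi w is in U2 and in W2,
    hence is 0: the projection to U1 preserves ker pi. *)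
Lemma copresent_indecomposable :
  limg pi = fullv -> \dim {:X} != 0 :> nat ->
  (forall U W : {vspace X}, (U + W = fullv)%VS -> (U :&: W = 0)%VS ->
    (forall x : {ffun 'I_r -> X}, x \in lker pi ->
       [ffun i => daddv_pi U W (x i)] \in lker pi) ->
    U = 0%VS \/ W = 0%VS) ->
  indecomposable copresent.
Proof.
move=> pi_surj X0 h; split=> [[d0 _]|U1 U2 W1 W2 [sU sW [UW1f UW10] [UW2f UW20]]].
  by rewrite d0 in X0.
have zero2 (A1 B1 : {vspace rep1 copresent}) (A2 B2 : {vspace rep2 copresent}) :
    subrep A1 A2 -> (A1 + B1 = fullv)%VS -> (A2 :&: B2 = 0)%VS ->
    B1 = 0%VS -> B2 = 0%VS.
  move=> sA AB1 AB2 B10; rewrite -AB2; apply/esym/capv_idPr/subvP => y _.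
  have : y \in limg pi by rewrite pi_surj memvf.
  case/memv_imgP => x _ ->; rewrite -sum_copresent; apply: sum_arrows_sub sA _ => i.
  by have := memvf (x i : X); rewrite -AB1 B10 addv0.
case: (h U1 W1 UW1f UW10) => [x xK|U10|W10].
- set u := finfun _; pose w := [ffun i => daddv_pi W1 U1 (x i)].
  have xE : x = u + w.
    by apply/ffunP => i; rewrite !ffunE daddv_pi_compl.
  have uU : pi u \in U2.
    by rewrite -sum_copresent; apply: sum_arrows_sub sU _ => i; rewrite ffunE memv_pi.
  have wW : pi w \in W2.
    by rewrite -sum_copresent; apply: sum_arrows_sub sW _ => i; rewrite ffunE memv_pi.
  rewrite memv_ker -memv0 -UW20 memv_cap uU /=.
  move: xK; rewrite memv_ker xE linearD addr_eq0 => /eqP ->.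
  by rewrite rpredN.
- by left; split=> //; apply: zero2 sW _ _ U10; rewrite 1?addvC 1?capvC.
- by right; split=> //; apply: zero2 sU _ _ W10.
Qed.

End Copresentation.

Lemma exists_quotient X (N : {vspace X}) :
  exists (Y : vectType k) (pi : 'Hom(X, Y)),
    [/\ lker pi = N, limg pi = fullv & \dim {:Y} = (\dim {:X} - \dim N)%N].
Proof.
pose f := (\1 - projv N : 'End(X))%VF; pose Q := limg f.
pose pi := linfun (fun x => vsproj Q (f x)).
have piE x : vsval (pi x) = f x.
  rewrite linfun_linearE ?vsprojK ?memv_img ?memvf // => c u v.
  by rewrite linearP linearP.
have kerN : lker pi = N.
  apply/vspaceP => x; rewrite memv_ker -(inj_eq val_inj) [val (pi x)]piE /=.
  rewrite add_lfunE opp_lfunE id_lfunE subr_eq0.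
  by apply/eqP/idP => [->|/projv_id ->]; rewrite ?memv_proj.
have pi_surj : limg pi = fullv.
  apply/vspaceP => y; rewrite memvf; have /memv_imgP [x _ yE] := subvsP y.
  by apply/memv_imgP; exists x; rewrite ?memvf //; apply: val_inj; rewrite [RHS]piE.
exists (subvs_of Q), pi; split=> //.
by rewrite -pi_surj -(limg_ker_dim pi fullv) capfv kerN addKn.
Qed.

End Form.

Section Existence.

Variables (k : fieldType) (r : nat).
Hypothesis r2 : (1 < r)%N.
Implicit Types (M L : kronecker_rep k r) (X Y : vectType k).

Lemma copresentation_exists X (N : {vspace {ffun 'I_r -> X}}) :
  \dim {:X} != 0 :> nat ->
  (forall (alpha : 'rV[k]_r) (x : X), alpha != 0 ->
    [ffun i => alpha 0 i *: x] \in N -> x = 0) ->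
  (forall U W : {vspace X}, (U + W = fullv)%VS -> (U :&: W = 0)%VS ->
    (forall x : {ffun 'I_r -> X}, x \in N -> [ffun i => daddv_pi U W (x i)] \in N) ->
    U = 0%VS \/ W = 0%VS) ->
  exists M, [/\ EKP M, indecomposable M
    & dim_vector M = (\dim {:X}, r * \dim {:X} - \dim N)%N].
Proof.
move=> X0 ekp ind; have [Y [pi [piN pi_surj dimY]]] := exists_quotient N.
exists (copresent pi); split.
- by apply: copresent_EKP; rewrite piN.
- by apply: copresent_indecomposable; rewrite ?piN.
- by rewrite /dim_vector /= dimY; congr (_, _ - _)%N; rewrite !dimvf /dim /= card_ord.
Qed.

(** Take N to be the image of L_1 in L_2^r.  If y in L_1 maps to the pure tensor
    alpha_i x, then L^beta y = 0 for each beta orthogonal to alpha, so y = 0.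
    A splitting of N along L_2 = U + W pulls back to a decomposition of L. *)
Lemma EKP_lift L : EKP L -> indecomposable L -> (dim_vector L).2 <> 0%N ->
  exists M, [/\ EKP M, indecomposable M
    & dim_vector M = ((dim_vector L).2, r * (dim_vector L).2 - (dim_vector L).1)%N].
Proof.
move=> ekp ind L2_0.
pose f (x : rep1 L) := [ffun i => rep_arrow L i x].
have fE x i : linfun f x i = rep_arrow L i x.
  by rewrite linfun_linearE ?ffunE // => c u v; apply/ffunP => j; rewrite !ffunE linearP.
have comb0 (beta : 'rV[k]_r) x : beta != 0 -> \sum_i beta 0 i *: rep_arrow L i x = 0 -> x = 0.
  move=> b0 sx; apply/eqP; rewrite -memv0 -(ekp beta b0) memv_ker /rep_comb sum_lfunE.
  by rewrite (eq_bigr (fun i => beta 0 i *: rep_arrow L i x)) ?sx // => i _;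
    rewrite scale_lfunE.
have inj x : (forall i, rep_arrow L i x = 0) -> x = 0.
  move=> h; apply: (comb0 (delta_mx 0 (Ordinal (ltnW r2)))).
    apply/eqP => /rowP/(_ (Ordinal (ltnW r2))); rewrite !mxE !eqxx => /eqP.
    by rewrite oner_eq0.
  by apply: big1 => i _; rewrite h scaler0.
have f_inj : lker (linfun f) = 0%VS.
  apply/eqP; rewrite -subv0; apply/subvP => x; rewrite memv_ker memv0 => /eqP fx.
  by apply/eqP/inj => i; rewrite -fE fx ffunE.
have := @copresentation_exists (rep2 L) (limg (linfun f)).
rewrite limg_dim_eq ?f_inj ?capv0 //; apply.
- exact/eqP.
- move=> alpha x a0 /memv_imgP [y _ yE].
  have [beta /(_ a0) b0 ab0] := dual_orthogonal r2 alpha.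
  have aE i : alpha 0 i *: x = rep_arrow L i y.
    by rewrite -fE -yE ffunE.
  have y0 : y = 0.
    apply: (comb0 beta _ b0); rewrite (eq_bigr (fun i => (beta 0 i * alpha 0 i) *: x)).
      by rewrite -scaler_suml ab0 scale0r.
    by move=> i _; rewrite -aE scalerA.
  have [i ai] : exists i, alpha 0 i != 0.
    apply/existsP; rewrite -negb_forall; apply: contra a0 => /forallP h.
    by apply/eqP/rowP => i; rewrite mxE; apply/eqP.
  by have /eqP := aE i; rewrite y0 linear0 scaler_eq0 (negPf ai) => /eqP.
move=> U W UWf UW0 stable.
pose pre (A : {vspace rep2 L}) := (\bigcap_i (rep_arrow L i @^-1: A))%VS.
have preP (A : {vspace rep2 L}) (x : rep1 L) :
    reflect (forall i, rep_arrow L i x \in A) (x \in pre A).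
  apply: (iffP idP) => [xA i|h].
    by rewrite memv_preim; move: xA; apply/subvP; rewrite /pre (bigD1 i) //= capvSl.
  rewrite /pre; elim/big_ind: _ => [|A1 A2 A1x A2x|i _]; first exact: memvf.
    by rewrite memv_cap A1x.
  by rewrite -memv_preim.
have sub_pre (A : {vspace rep2 L}) : subrep (pre A) A.
  by move=> i; apply/subvP => _ /memv_imgP [x /preP xA ->].
case: (ind.2 (pre U) U (pre W) W); last 2 first.
- by case; left.
- by case; right.
split=> //; split; apply/vspaceP => x; rewrite ?memvf ?memv0 //.
  have [|y _ yE] := memv_imgP (stable (linfun f x) _); first by rewrite memv_img ?memvf.
  have yP i : rep_arrow L i y = daddv_pi U W (rep_arrow L i x).
    by rewrite -fE -yE ffunE fE.
  apply/memv_addP; exists y; first by apply/preP => i; rewrite yP memv_pi.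
  exists (x - y); last by rewrite addrC subrK.
  apply/preP => i; rewrite linearB /= yP.
  by rewrite -{1}(daddv_pi_compl (rep_arrow L i x) UWf UW0) addrC addKr memv_pi.
apply/idP/eqP => [|->]; last exact: mem0v.
rewrite memv_cap => /andP [/preP xU /preP xW]; apply: inj => i; apply/eqP.
by rewrite -memv0 -UW0 memv_cap xU xW.
Qed.

Lemma simple2_exists : exists M, [/\ EKP M, indecomposable M & dim_vector M = (0, 1)%N].
Proof.
pose M : kronecker_rep k r := KroneckerRep (fun _ => 0 : 'Hom('rV[k]_0, k^o)).
have M1_0 : {:rep1 M}%VS = 0%VS by apply/eqP; rewrite -dimv_eq0 dimvf.
have A0 (A : {vspace rep1 M}) : A = 0%VS by apply/eqP; rewrite -subv0 -M1_0 subvf.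
have dM : dim_vector M = (0, 1)%N by rewrite /dim_vector !dimvf.
exists M; split; [by move=> alpha _; exact: A0 | | exact: dM].
split=> [|U1 U2 W1 W2 [_ _ _ [UW UW0]]]; first by rewrite dM.
have : (\dim U2 + \dim W2 = 1)%N.
  by rewrite -dimv_sum_cap UW UW0 dimv0 addn0 dimvf.
case: (ltnP 0 (\dim U2)) => [U2_0 UW1|].
  by right; split=> //; apply/eqP; rewrite -dimv_eq0; apply/eqP; lia.
by rewrite leqn0 dimv_eq0 => /eqP U2_0 _; left.
Qed.

End Existence.

Lemma intermediate_vspace (k : fieldType) (V : vectType k) (S T : {vspace V}) n :
  (S <= T)%VS -> (\dim S <= n <= \dim T)%N ->
  exists N : {vspace V}, [/\ (S <= N)%VS, (N <= T)%VS & \dim N = n].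
Proof.
move=> ST; have [e] := ubnP (n - \dim S); elim: e S ST => // e IH S ST en /andP [Sn nT].
have [Sn'|nS] := ltnP (\dim S) n; last first.
  by exists S; split=> //; apply/eqP; rewrite eqn_leq Sn nS.
have [v vT vS] : exists2 v, v \in T & v \notin S.
  apply: contrapT => /forallPNP h; have TS : (T <= S)%VS.
    by apply/subvP => v /h /negP; rewrite negbK.
  by have := dimvS TS; lia.
have dSv : \dim (S + <[v]>) = (\dim S).+1.
  have v0 : v != 0 by apply: contra vS => /eqP ->; apply: mem0v.
  rewrite dimv_disjoint_sum ?dim_vline ?v0 ?addn1 //.
  apply/eqP; rewrite -subv0; apply/subvP => u; rewrite memv_cap => /andP [uS /vlineP [x uE]].
  move: uS; rewrite uE memv0 scaler_eq0; have [->//|x0] := eqVneq x 0.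
  by rewrite rpredZeq (negPf x0) (negPf vS).
have [|||N [SN NT dN]] := IH (S + <[v]>)%VS.
- by rewrite subv_add ST -memvE.
- by rewrite dSv; lia.
- by rewrite dSv Sn'.
by exists N; split=> //; apply: subv_trans SN; apply: addvSl.
Qed.

(** * Spaces of polynomial syzygies *)

(** Row vectors of length a are read as polynomials of degree < a. *)
Section PolynomialFamilies.

Variables (k : fieldType) (r a : nat).
Hypotheses (r2 : (1 < r)%N) (a_gt0 : (0 < a)%N).

Definition on_poly (phi : 'End('rV[k]_a)) (p : {poly k}) : {poly k} :=
  rVpoly (phi (poly_rV p)).

Lemma on_polyB phi p q : on_poly phi (p - q) = on_poly phi p - on_poly phi q.
Proof. by rewrite /on_poly !linearB. Qed.

Lemma size_rVpoly n (v : 'rV[k]_n) : (size (rVpoly v) <= n)%N.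
Proof. exact: size_poly. Qed.

(** Commuting with multiplication by t means phi p = p g with g = phi 1, and
    deg (t^(a-1) g) < a makes g constant. *)
Lemma on_poly_scalar phi :
  (forall j, (j.+1 < a)%N -> on_poly phi 'X^(j.+1) = 'X * on_poly phi 'X^j) ->
  exists c, forall x, phi x = c *: x.
Proof.
move=> shift; have onX j : (j < a)%N -> on_poly phi 'X^j = 'X^j * on_poly phi 1.
  elim: j => [|j IH] ja; first by rewrite expr0 mul1r.
  by rewrite shift // IH ?(ltnW ja) // exprS mulrA.
set g := on_poly phi 1 in onX.
have [c gc] : exists c, g = c%:P.
  have [->|g0] := eqVneq g 0; first by exists 0.
  exists g`_0; apply: size1_polyC.
  have := size_rVpoly (phi (poly_rV 'X^(a.-1))).
  rewrite -/(on_poly phi _) onX ?prednK // mulrC size_mulXn //.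
  by move: a_gt0; case: (a) => // n _; lia.
exists c => x; apply: (can_inj rVpolyK).
rewrite (row_sum_delta x) scaler_sumr !linear_sum /=; apply: eq_bigr => j _.
rewrite !linearZ /= rVpoly_delta.
have -> : delta_mx 0 j = poly_rV 'X^j :> 'rV[k]_a by rewrite -rVpoly_delta rVpolyK.
by rewrite -/(on_poly phi _) onX // gc mulrC mul_polyC !scalerA mulrC.
Qed.

(** The zeros of this map are the syzygies of 1, t, ..., t^(r-1). *)
Definition conv (x : {ffun 'I_r -> 'rV[k]_a}) : {poly k} := \sum_(i < r) 'X^i * rVpoly (x i).

(** A syzygy of the form alpha_i g satisfies (sum_i alpha_i t^i) g = 0, so it is
    0 for alpha <> 0.  The second hypothesis makes every endomorphism of X that
    preserves N a scalar; applied to projections, it forbids a splitting. *)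
Lemma poly_copresentation (N : {vspace {ffun 'I_r -> 'rV[k]_a}}) :
  (forall x, x \in N -> conv x = 0) ->
  (forall phi : 'End('rV[k]_a),
     (forall x : {ffun 'I_r -> 'rV[k]_a}, x \in N -> [ffun i => phi (x i)] \in N) ->
     forall j, (j.+1 < a)%N -> on_poly phi 'X^(j.+1) = 'X * on_poly phi 'X^j) ->
  exists M : kronecker_rep k r,
    [/\ EKP M, indecomposable M & dim_vector M = (a, r * a - \dim N)%N].
Proof.
move=> N0 rigid; have dX : \dim {:'rV[k]_a} = a by rewrite dimvf /dim /= mul1n.
have := @copresentation_exists k r 'rV[k]_a N; rewrite dX; apply.
- by rewrite -lt0n.
- move=> alpha x a0 /N0; rewrite /conv => eq0.
  have : (\sum_(i < r) alpha 0 i *: 'X^i) * rVpoly x = 0.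
    rewrite -[RHS]eq0 mulr_suml; apply: eq_bigr => i _.
    by rewrite ffunE linearZ /= -scalerAl scalerAr.
  move/eqP; rewrite mulf_eq0 => /orP [/eqP alpha0|/eqP x0]; last first.
    by apply: (can_inj rVpolyK); rewrite x0 linear0.
  case/negP: a0; apply/eqP/rowP => i; rewrite mxE.
  have := congr1 (fun p : {poly k} => p`_i) alpha0.
  rewrite coef0 coef_sum (bigD1 i) //= coefZ coefXn eqxx mulr1 big1 ?addr0 // => j ji.
  by rewrite coefZ coefXn eq_sym val_eqE (negPf ji) mulr0.
move=> U W UWf UW0 stable.
have [c phiE] := on_poly_scalar (rigid _ stable).
have [c0|c0] := eqVneq c 0; [left|right]; apply/eqP; rewrite -subv0; apply/subvP => x xU.
  by rewrite memv0 -(daddv_pi_id UW0 xU) phiE c0 scale0r.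
have := daddv_pi_compl x UWf UW0; rewrite [X in _ + X]daddv_pi_id 1?capvC //.
move/eqP; rewrite phiE -subr_eq0 addrK scaler_eq0 (negPf c0) memv0.
by [].
Qed.

Section SyzygyMultiples.

Variables (w : nat -> {poly k}) (n : nat).
Hypothesis w_size : forall i, (size (w i) + n <= a.+1)%N.

(** The tuples (w_i p)_i for p of degree < n. *)
Definition multiples : 'Hom('rV[k]_n, {ffun 'I_r -> 'rV[k]_a}) :=
  linfun (fun y => [ffun i : 'I_r => poly_rV (w i * rVpoly y)] : {ffun 'I_r -> 'rV[k]_a}).

Lemma multiplesE y i : multiples y i = poly_rV (w i * rVpoly y).
Proof.
rewrite /multiples linfun_linearE ?ffunE // => c u v; apply/ffunP => j.
by rewrite !ffunE linearP mulrDr -scalerAr linearP.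
Qed.

Lemma rVpoly_multiples y i : rVpoly (multiples y i) = w i * rVpoly y.
Proof.
rewrite multiplesE poly_rV_K //; apply: leq_trans (size_polyMleq _ _) _.
by have := w_size i; have := size_rVpoly y; lia.
Qed.

Lemma conv_multiples y : conv (multiples y) = (\sum_(i < r) 'X^i * w i) * rVpoly y.
Proof.
by rewrite mulr_suml; apply: eq_bigr => i _; rewrite rVpoly_multiples mulrA.
Qed.

Lemma on_poly_multiples (phi : 'End('rV[k]_a)) i y :
  rVpoly (phi (multiples y i)) = on_poly phi (w i * rVpoly y).
Proof. by rewrite multiplesE. Qed.

End SyzygyMultiples.

Lemma conv_linear : linear conv.
Proof.
move=> c x y; rewrite scaler_sumr -big_split; apply: eq_bigr => i _ /=.
by rewrite !ffunE linearP mulrDr -scalerAr.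
Qed.

Lemma size_conv x : (size (conv x) <= (a + r).-1)%N.
Proof.
apply: leq_trans (size_sum _ _ _) _; apply/bigmax_leqP => i _.
apply: leq_trans (size_polyMleq _ _) _; rewrite size_polyXn.
by have := size_rVpoly (x i); have := ltn_ord i; lia.
Qed.

Lemma dim_rV n : \dim {:'rV[k]_n} = n.
Proof. by rewrite dimvf /dim /= mul1n. Qed.

Lemma dim_ffun_rV : \dim {:{ffun 'I_r -> 'rV[k]_a}} = (r * a)%N.
Proof. by rewrite dimvf [LHS]/dim /= -dimvf dim_rV card_ord. Qed.

Lemma conv_kernel : exists2 N0 : {vspace {ffun 'I_r -> 'rV[k]_a}},
  (forall x, (x \in N0) = (conv x == 0)) & (r * a <= \dim N0 + (a + r).-1)%N.
Proof.
pose f x : 'rV[k]_((a + r).-1) := poly_rV (conv x).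
have fE x : rVpoly (linfun f x) = conv x.
  rewrite linfun_linearE ?poly_rV_K ?size_conv // => c u v.
  by rewrite /f conv_linear linearP.
exists (lker (linfun f)) => [x|].
  by rewrite memv_ker -(inj_eq (can_inj rVpolyK)) fE linear0.
have := limg_ker_dim (linfun f) fullv; rewrite capfv => dimE.
have := dimvS (subvf (limg (linfun f))).
by rewrite dim_ffun_rV in dimE; rewrite dim_rV -dimE leq_add2l.
Qed.

(** N can be any space of syzygies that contains all (t p, -p, 0, ..., 0): that
    phi preserves N then gives phi (t p) - t phi p = 0.  The bounds on b say that
    dim N = r a - b lies between a - 1 and the dimension of the space of all
    syzygies. *)
Lemma near_diagonal_exists b : (a + r <= b.+1)%N -> (b + a <= r * a + 1)%N ->
  exists M : kronecker_rep k r,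
    [/\ EKP M, indecomposable M & dim_vector M = (a, b)].
Proof.
move=> ab ba; pose w i : {poly k} := if i is 0 then 'X else if i is 1 then -1 else 0.
have w_size i : (size (w i) + a.-1 <= a.+1)%N.
  by case: i => [|[|i]] /=; rewrite ?size_polyX ?size_polyN ?size_poly1 ?size_poly0; lia.
have [p rE] : exists p, r = p.+2 by exists r.-2; lia.
have w0 : \sum_(i < r) 'X^i * w i = 0.
  rewrite rE !big_ord_recl big1 => [|i _] /=; last by rewrite mulr0.
  by rewrite expr0 expr1; ring.
have [N0 N0P dN0] := conv_kernel.
have [||N [SN NN0 dN]] := @intermediate_vspace _ _ (limg (multiples w a.-1)) N0 (r * a - b)%N.
- by apply/subvP => _ /memv_imgP [y _ ->]; rewrite N0P conv_multiples // w0 mul0r.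
- have dS : (\dim (limg (multiples w a.-1)) <= a.-1)%N.
    by rewrite -[leqRHS]dim_rV -(limg_ker_dim (multiples w a.-1) fullv) leq_addl.
  apply/andP; split; first by apply: leq_trans dS _; clear -ba; lia.
  by rewrite leq_subLR (leq_trans dN0) // addnC leq_add2r; clear -ab a_gt0; lia.
have <- : (r * a - \dim N = b)%N by rewrite dN; lia.
apply: poly_copresentation => [x /(subvP NN0)|phi stable j ja].
  by rewrite N0P => /eqP.
have jX : rVpoly (poly_rV 'X^j : 'rV[k]_a.-1) = 'X^j.
  by rewrite poly_rV_K // size_polyXn; lia.
have : multiples w a.-1 (poly_rV 'X^j) \in N by apply/(subvP SN)/memv_img/memvf.
move/stable/(subvP NN0); rewrite N0P /conv => /eqP.
under eq_bigr => i _ do rewrite ffunE on_poly_multiples jX.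
have on0 : on_poly phi 0 = 0 by rewrite /on_poly !linear0.
have onN p1 : on_poly phi (- p1) = - on_poly phi p1 by rewrite /on_poly !linearN.
rewrite rE !big_ord_recl big1 => [|i _] /=; last by rewrite mul0r on0 mulr0.
rewrite expr0 expr1 mul1r addr0 mulN1r onN mulrN -exprS => /eqP.
by rewrite subr_eq0 => /eqP.
Qed.

End PolynomialFamilies.

(** The components t, t - 1, t^2 - 1, t^3 - t, ..., t^c - t^(c-2), - t^(c-1), 0, ...
    of the syzygy s_0 + sum_(j < c) t^j s_(j+1), with s_i = t e_i - e_(i+1).
    Up to index c they span the polynomials of degree <= c. *)
Definition omega (k : fieldType) (c i : nat) : {poly k} :=
  if i is i'.+2 then
    if (i <= c)%N then 'X^i - 'X^i' else if i == c.+1 then - 'X^i' else 0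
  else if i is 1 then 'X - 1 else 'X.

Lemma size_omega (k : fieldType) c i : (0 < c)%N -> (size (omega k c i) <= c.+1)%N.
Proof.
case: i => [|[|i]] c0 /=; rewrite ?size_polyX ?size_XsubC //.
case: ltnP => [ic|_].
  by rewrite (leq_trans (size_polyD _ _)) // geq_max size_polyN !size_polyXn; lia.
by case: eqP => [[<-]|_]; rewrite ?size_polyN ?size_polyXn ?size_poly0; lia.
Qed.

Lemma conv_omega (k : fieldType) r c : (0 < c)%N -> (c.+1 < r)%N ->
  \sum_(i < r) 'X^i * omega k c i = 0.
Proof.
move=> c0 cr; rewrite -(big_mkord predT (fun i => 'X^i * omega k c i)).
have head e : (e < c)%N -> \sum_(0 <= i < e.+2) 'X^i * omega k c i = 'X^(e.+1) * 'X^(e.+1).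
  elim: e => [|e IH] ec.
    by rewrite !big_nat_recr //= big_nil expr0 expr1; ring.
  rewrite big_nat_recr //= IH ?(ltnW ec) // ec !exprS; ring.
rewrite (big_cat_nat (n := c.+2)) //= [X in _ + X]big_nat [X in _ + X]big1 ?addr0; last first.
  move=> i /andP [ci _]; case: i ci => [|[|i]] ci //=.
  have -> : (i.+1 < c)%N = false by lia.
  by have -> : (i.+2 == c.+1) = false by [lia|]; rewrite mulr0.
case: c c0 cr head => // c _ cr head.
rewrite big_nat_recr //= head // ltnn eqxx !exprS; ring.
Qed.

(** * Dimension vectors of EKP representations *)

Section Realization.

Variables (k : fieldType) (r : nat).
Hypothesis r2 : (1 < r)%N.

(** If phi preserves the multiples of omega, then for each p of degree < a - c
    there is a q with phi (omega_i p) = omega_i q for all i.  As the omega_i span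
    1, t, ..., t^c, this gives phi (t^e p) = t^e phi p for e <= c. *)
Lemma far_diagonal_exists a c : (0 < c)%N -> (c < a)%N -> (c.+1 < r)%N ->
  exists M : kronecker_rep k r,
    [/\ EKP M, indecomposable M & dim_vector M = (a, r * a - (a - c))%N].
Proof.
move=> c0 ca cr; set n := (a - c)%N; have a0 : (0 < a)%N by lia.
have w_size i : (size (omega k c i) + n <= a.+1)%N.
  by have := size_omega k i c0; rewrite /n; lia.
pose f := @multiples k r a (omega k c) n.
have fE y i : rVpoly (f y i) = omega k c i * rVpoly y by apply: rVpoly_multiples.
have dN : \dim (limg f) = n.
  rewrite limg_dim_eq ?dim_rV //; apply/eqP; rewrite -subv0; apply/subvP => y.
  rewrite memv_cap memv_ker memv0 => /andP [_ /eqP y0].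
  have := fE y (Ordinal (ltnW r2)); rewrite y0 ffunE linear0 /= => /esym/eqP.
  rewrite mulf_eq0 polyX_eq0 /= => /eqP y0'; apply/eqP/(can_inj rVpolyK).
  by rewrite y0' linear0.
rewrite -dN; apply: (poly_copresentation r2 a0) => [_ /memv_imgP [y _ ->]|phi stable].
  by rewrite conv_multiples // conv_omega // mul0r.
have quot j : (j < n)%N -> exists q, forall i : 'I_r,
    on_poly phi (omega k c i * 'X^j) = omega k c i * q.
  move=> jn; have jX : rVpoly (poly_rV 'X^j : 'rV[k]_n) = 'X^j.
    by rewrite poly_rV_K // size_polyXn.
  have /stable /memv_imgP [y _ yE] := memv_img f (memvf (poly_rV 'X^j : 'rV[k]_n)).
  by exists (rVpoly y) => i; rewrite -fE -yE ffunE on_poly_multiples jX.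
have shift e j : (j < n)%N -> (e <= c)%N ->
    on_poly phi ('X^e * 'X^j) = 'X^e * on_poly phi 'X^j.
  move=> jn; have [q qE] := quot j jn.
  have q1 : on_poly phi ('X * 'X^j) = 'X * q := qE (Ordinal (ltnW r2)).
  have q0 : on_poly phi 'X^j = q.
    have := qE (Ordinal r2); rewrite /= !mulrBl !mul1r on_polyB q1.
    by move/addrI/oppr_inj.
  rewrite q0; have [m] := ubnP e; elim: m e => // m IH [|[|e]] em ec.
  - by rewrite expr0 !mul1r.
  - by rewrite expr1.
  have er : (e.+2 < r)%N by lia.
  have := qE (Ordinal er); rewrite /= ec !mulrBl on_polyB (IH e) //; try lia.
  by move/addIr.
move=> j ja; have [jn|nj] := ltnP j n.
  by have := shift 1%N j jn c0; rewrite expr1 -exprS.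
have [e [-> ec]] : exists e, (j = e + n.-1 /\ e < c)%N.
  by exists (j - n.-1)%N; rewrite /n in nj *; lia.
have n0 : (n.-1 < n)%N by rewrite /n; lia.
by rewrite -addSn !exprD !shift ?(ltnW ec) // exprS mulrA.
Qed.

(** Induction on a; for c = b - (r - 1) a >= r - 1 the pair (r a - b, a) satisfies
    the same hypotheses.  Otherwise c <= r - 2, and q(a, b) <= 1 gives c < a when
    c >= 2. *)
Lemma EKP_exists a b :
  kronecker_form r a%:Z b%:Z <= 1 ->
  r%:Z - 1 <= b%:Z - a%:Z \/ (a, b) = (0, 1)%N ->
  exists M : kronecker_rep k r,
    [/\ EKP M, indecomposable M & dim_vector M = (a, b)].
Proof.
rewrite kronecker_form_le1; have [n] := ubnP a.
elim: n a b => // n IH a b an q1 [ab|[-> ->]]; last exact: simple2_exists.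
have [a0|a_gt0] := posnP a.
  have -> : b = 1%N by move: q1 ab; rewrite a0 !muln0; nia.
  by rewrite a0; apply: simple2_exists.
have b_le : (b <= r * a)%N by nia.
have [big|small] := leqP (r.-1 * a.+1) b.
  have [|||L [ekpL indL dL]] := IH (r * a - b)%N a.
  - by nia.
  - have [c cE] : exists c, (r * a = c + b)%N by exists (r * a - b)%N; lia.
    by rewrite cE addnK; nia.
  - by left; nia.
  have := EKP_lift r2 ekpL indL; rewrite dL /= => /(_ (elimN eqP (lt0n_neq0 a_gt0))).
  by rewrite subKn.
have [near|far] := leqP (b + a) (r * a + 1).
  by apply: near_diagonal_exists => //; lia.
have [||| M [ekpM indM dM]] := @far_diagonal_exists a (b + a - r * a).
- by lia.
- by nia.
- by nia.
exists M; split=> //; rewrite dM; congr (_, _); nia.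
Qed.

End Realization.

Theorem theorem4p1 (k : closedFieldType) (r : nat) (hr : (2 <= r)%N) :
  (forall a b : nat,
      kronecker_form r a%:Z b%:Z <= 1 ->
      r%:Z - 1 <= b%:Z - a%:Z \/ (a, b) = (0, 1)%N ->
      exists V : kronecker_rep k r,
        [/\ indecomposable V, equal_kernels_property V
          & dim_vector V = (a, b)]) /\
  [set d : nat * nat | exists M : kronecker_rep k r,
      [/\ EKP M, indecomposable M & dim_vector M = d]] =
  [set d : nat * nat | kronecker_form r d.1%:Z d.2%:Z <= 1 /\
                       r%:Z - 1 <= d.2%:Z - d.1%:Z] `|` [set (0, 1)%N].
Proof.
split=> [a b q1 ab|].
  have [V [ekpV indV dV]] := EKP_exists k hr q1 ab.
  by exists V; split=> // alpha beta a0 b0; rewrite !ekpV.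
apply/seteqP; split=> [_ [M [ekpM indM <-]]|[a b] /=].
  have [a0|a0] := posnP (dim_vector M).1.
    right; have b1 := indecomposable_dim1_0 indM a0.
    by rewrite /= [dim_vector M]surjective_pairing a0 b1.
  have dimM := EKP_dim (ltnW hr) a0 ekpM.
  left; split; last by lia.
  by apply: indecomposable_form => //; lia.
case=> [[q1 ab]|[-> ->]]; first by apply: (EKP_exists k hr q1); left.
exact: simple2_exists.
Qed.
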